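(* Let $G$ be a pseudo-split graph with $V(G)=S\cup C\cup I$, where $C\neq\emptyset$ induces a clique, $I$ induces an independent set, and $S\neq\emptyset$ induces a $5$-cycle $C_5$. Then $\chi_{pcf}(G)=\omega(G)+1$.
   Context: All graphs are finite, simple, connected and undirected. $N(v)$ is the open neighborhood of $v$, $[k]=\{1,\dots,k\}$, and $\omega(G)$ is the maximum size of a clique of $G$. A proper conflict-free (PCF) $k$-coloring of a graph $G$ is a proper coloring $f:V(G)\to[k]$ such that for every non-isolated vertex $v$ there is a color (depending on $v$) that appears on exactly one vertex of $N(v)$. $\chi_{pcf}(G)$ is the least $k$ such that $G$ admits a PCF $k$-coloring. $G$ is pseudo-split if $V(G)$ can be partitioned into three (possibly empty) sets $C,S,I$ such that $C$ induces a clique, $I$ induces an independent set, $S$ induces a $C_5$ (if nonempty), every vertex of $C$ is adjacent to every vertex of $S$, and every vertex of $I$ is non-adjacent to every vertex of $S$. In the claim, $S,C,I$ is such a partition. *)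

(* Defs.v *)
From HB Require Import structures.
From mathcomp Require Import all_boot.

Set Implicit Arguments.
Unset Strict Implicit.
Unset Printing Implicit Defensive.

Record sgraph := SGraph {
  vertex :> finType;
  adj : rel vertex;
  adj_sym : symmetric adj;
  adj_irrefl : irreflexive adj
}.

Section Graph.
Variable G : sgraph.

Definition nbhd (v : G) : {set G} := [set u | adj v u].

Definition connected_graph : Prop :=
  (0 < #|G|) /\ (forall u v : G, connect (@adj G) u v).

Definition clique (K : {set G}) : bool :=
  [forall u in K, forall v in K, (u != v) ==> adj u v].

Definition independent (K : {set G}) : bool :=
  [forall u in K, forall v in K, ~~ adj u v].

Definition omega : nat := \max_(K : {set G} | clique K) #|K|.

(* The k colors are the elements 0, ..., k-1 of 'I_k, standing for [k]. *)
Definition proper_coloring (k : nat) (f : {ffun G -> 'I_k}) : bool :=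
  [forall u, forall v, adj u v ==> (f u != f v)].

Definition conflict_free (k : nat) (f : {ffun G -> 'I_k}) : bool :=
  [forall v, (nbhd v != set0) ==>
     [exists c : 'I_k, #|[set u in nbhd v | f u == c]| == 1]].

Definition pcf_colorable (k : nat) : bool :=
  [exists f : {ffun G -> 'I_k}, proper_coloring f && conflict_free f].

Lemma pcf_colorable_ex : exists k, pcf_colorable k.
Proof.
exists #|G|; apply/existsP; exists [ffun v => enum_rank v].
apply/andP; split.
  apply/forallP=> u; apply/forallP=> v; apply/implyP=> uv.
  rewrite !ffunE (inj_eq enum_rank_inj); apply: contraTneq uv => ->.
  by rewrite adj_irrefl.
apply/forallP=> v; apply/implyP=> /set0Pn[u vu].
apply/existsP; exists (enum_rank u); apply/cards1P; exists u.
apply/setP=> w; rewrite !inE ffunE (inj_eq enum_rank_inj).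
by case: eqP => [->|_]; rewrite ?andbF // andbT; move: vu; rewrite inE.
Qed.

Definition chi_pcf : nat := ex_minn pcf_colorable_ex.

(* The vertices of C_5 are numbered cyclically; [ordS] is successor mod 5. *)
Definition C5_adj : rel 'I_5 := fun i j => (j == ordS i) || (i == ordS j).

Definition induces_C5 (S : {set G}) : Prop :=
  exists f : 'I_5 -> G,
    [/\ injective f, f @: [set: 'I_5] = S
      & forall i j, adj (f i) (f j) = C5_adj i j].

Record pseudo_split_partition (C S I : {set G}) : Prop := PseudoSplitPartition {
  psp_cover : C :|: S :|: I = [set: G];
  psp_disjCS : [disjoint C & S];
  psp_disjCI : [disjoint C & I];
  psp_disjSI : [disjoint S & I];
  psp_clique : clique C;
  psp_independent : independent I;
  psp_C5 : S != set0 -> induces_C5 S;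
  psp_complete : forall u v, u \in C -> v \in S -> adj u v;
  psp_anticomplete : forall u v, u \in I -> v \in S -> ~~ adj u v
}.

End Graph.

(* Main.v *)
(* Put c = |C|.  A clique meeting I lies in C plus one vertex, and a clique
   avoiding I has at most two vertices in S, so omega(G) = c + 2.  A proper
   coloring uses c colors on C and at least three others on the 5-cycle S,
   whence the lower bound c + 3.  Conversely, give C the colors 0, ..., c-1,
   the cycle S the colors c, c+1, c, c+1, c+2, and all of I the color c: the
   color c+2 occurs once in G, and so do the colors of C, while each vertex of C
   sees all of S and each non-isolated vertex outside C sees a vertex of C. *)
Require Import Defs.
From HB Require Import structures.
From mathcomp Require Import all_boot.

Set Implicit Arguments.
Unset Strict Implicit.
Unset Printing Implicit Defensive.

Lemma C5_adj_triangle_free i j k : C5_adj i j -> C5_adj j k -> ~~ C5_adj i k.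
Proof.
by case: i j k => [[|[|[|[|[|?]]]]] ?] [[|[|[|[|[|?]]]]] ?] [[|[|[|[|[|?]]]]] ?].
Qed.

(** An odd cycle has no proper 2-coloring: were colors to alternate along 0, 1, 2, 3, vertex 4 would
    see both of them. *)
Lemma C5_proper_card (T : finType) (e : 'I_5 -> T) :
  (forall i, e i != e (ordS i)) -> 2 < #|e @: [set: 'I_5]|.
Proof.
move=> eS; have e_in i : e i \in e @: [set: 'I_5] by exact: imset_f.
have eSE (i j : 'I_5) : j = i.+1 %% 5 :> nat -> e i != e j.
  by move=> ij; rewrite (_ : j = ordS i) ?eS //; apply: val_inj.
pose o n := inord n : 'I_5.
have oE n : n < 5 -> o n = n :> nat by exact: inordK.
have ne01 : e (o 0) != e (o 1) by apply: eSE; rewrite !oE.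
have ne12 : e (o 1) != e (o 2) by apply: eSE; rewrite !oE.
have ne23 : e (o 2) != e (o 3) by apply: eSE; rewrite !oE.
have ne34 : e (o 3) != e (o 4) by apply: eSE; rewrite !oE.
have ne40 : e (o 4) != e (o 0) by apply: eSE; rewrite !oE.
apply/card_gt2P; have [e20|ne20] := eqVneq (e (o 2)) (e (o 0)); last first.
  by exists (e (o 0)), (e (o 1)), (e (o 2)).
have [e31|ne31] := eqVneq (e (o 3)) (e (o 1)); last first.
  by exists (e (o 1)), (e (o 2)), (e (o 3)).
(* Now [e (o 4)] differs from [e (o 1)] through the edge 34 and from [e (o 0)] through the edge
   40. *)
rewrite e31 in ne34.
by exists (e (o 0)), (e (o 1)), (e (o 4)).
Qed.

Section PseudoSplit.

Variables (G : sgraph) (C S I : {set G}).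
Hypotheses (hpart : pseudo_split_partition C S I) (hS : S != set0).

Lemma cliqueP (K : {set G}) :
  reflect {in K &, forall u v, u != v -> adj u v} (clique K).
Proof.
apply: (iffP forall_inP) => [cK u v uK vK | cK u uK].
  by move/forall_inP/(_ v vK)/implyP: (cK u uK).
by apply/forall_inP => v vK; apply/implyP; apply: cK.
Qed.

Lemma adj_neq (u v : G) : adj u v -> u != v.
Proof. by apply: contraTneq => ->; rewrite adj_irrefl. Qed.

(** Independence of [I] and the absence of edges between [I] and [S] leave only [C] for a
    neighbor. *)
Lemma independent_part_nbhd u v : u \in I -> adj u v -> v \in C.
Proof.
move=> uI uv; have: v \in C :|: S :|: I by rewrite (psp_cover hpart) inE.
rewrite !inE -orbA => /or3P[// | vS | vI].
  by have := psp_anticomplete hpart uI vS; rewrite uv.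
have /forall_inP/(_ u uI)/forall_inP/(_ v vI) := psp_independent hpart.
by rewrite uv.
Qed.

(** Three common vertices would pull back along [g] to a triangle in the 5-cycle. *)
Lemma clique_cap_C5 (K : {set G}) : clique K -> #|K :&: S| <= 2.
Proof.
have [g [_ gS gadj]] := psp_C5 hpart hS.
move=> /cliqueP cK; rewrite leqNgt; apply/negP => /card_gt2P[x [y [z []]]].
rewrite -gS !inE => -[/andP[xK /imsetP[i _ xi]] /andP[yK /imsetP[j _ yj]]].
move=> /andP[zK /imsetP[k _ zk]] [xy yz zx].
have xyA := cK _ _ xK yK xy; have yzA := cK _ _ yK zK yz.
have xzA : adj x z by apply: cK; rewrite // eq_sym.
subst x y z; rewrite !gadj in xyA yzA xzA.
by have := C5_adj_triangle_free xyA yzA; rewrite xzA.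
Qed.

Lemma omega_pseudo_split : omega G = #|C| + 2.
Proof.
have cC := psp_clique hpart.
apply/eqP; rewrite eqn_leq; apply/andP; split.
  apply/bigmax_leqP => K cK.
  have [/eqP KI0 | /set0Pn[w /setIP[wK wI]]] := boolP (K :&: I == set0).
    have KCS : K \subset C :|: (K :&: S).
      apply/subsetP => v vK.
      have: v \in C :|: S :|: I by rewrite (psp_cover hpart) inE.
      have : v \notin K :&: I by rewrite KI0 inE.
      by rewrite !inE vK /= => /negbTE->; rewrite orbF.
    apply: leq_trans (subset_leq_card KCS) _.
    by apply: leq_trans (leq_card_setU _ _) _; rewrite leq_add2l clique_cap_C5.
  (* The other vertices of [K] are neighbors of [w], which lies in [I]. *)
  have KwC : K \subset w |: C.
    apply/subsetP => v vK; rewrite !inE; case: eqVneq => //= vw.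
    apply: independent_part_nbhd wI _.
    by move/cliqueP: cK; apply; rewrite // eq_sym.
  apply: leq_trans (subset_leq_card KwC) _.
  by rewrite cardsU1 addnC leq_add2l; case: (w \notin C).
have [g [ginj gS gadj]] := psp_C5 hpart hS.
have gin i : g i \in S by rewrite -gS imset_f.
(* An edge of the cycle together with [C] attains the bound. *)
pose x := g ord0; pose y := g (ordS ord0).
have xy : adj x y by rewrite gadj /C5_adj eqxx.
have xyS : [set x; y] \subset S by rewrite subUset !sub1set !gin.
have cK : clique (C :|: [set x; y]).
  apply/cliqueP => u v /setUP[uC | uxy] /setUP[vC | vxy] uv.
  - by move/cliqueP: cC; apply.
  - exact: psp_complete hpart _ _ uC (subsetP xyS v vxy).
  - by rewrite adj_sym; apply: psp_complete hpart _ _ vC (subsetP xyS u uxy).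
  - move: uxy vxy uv => /set2P[]-> /set2P[]->; rewrite ?eqxx //.
    by rewrite adj_sym.
suff <- : #|C :|: [set x; y]| = #|C| + 2 by apply: leq_bigmax_cond.
rewrite cardsU cards2 (adj_neq xy) (_ : C :&: _ = set0) ?cards0 ?subn0 //.
apply/eqP; rewrite setI_eq0; apply: disjointWr xyS _.
exact: psp_disjCS hpart.
Qed.

Lemma proper_coloring_lower_bound k (f : {ffun G -> 'I_k}) :
  proper_coloring f -> #|C| + 3 <= k.
Proof.
move=> /forallP pf.
have fP u v : adj u v -> f u != f v.
  by move=> uv; move/forallP/(_ v)/implyP: (pf u); apply.
have [g [_ gS gadj]] := psp_C5 hpart hS.
have finj : {in C &, injective f}.
  move=> u v uC vC /eqP; apply: contraTeq => uv; apply: fP.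
  by move/cliqueP: (psp_clique hpart); apply.
have fS3 : 2 < #|f @: S|.
  rewrite -gS -imset_comp; apply: C5_proper_card => i /=.
  by apply: fP; rewrite gadj /C5_adj eqxx.
(* Every vertex of [C] is adjacent to every vertex of [S], so no color is shared. *)
have dCS : f @: C :&: f @: S = set0.
  apply/eqP; rewrite setI_eq0; apply/pred0P => c /=.
  apply/negP => /andP[/imsetP[u uC ->] /imsetP[v vS]]; apply/eqP/fP.
  exact: psp_complete hpart _ _ uC vS.
have := max_card [in f @: C :|: f @: S].
rewrite card_ord cardsU dCS cards0 subn0 card_in_imset //.
by apply: leq_trans; rewrite leq_add2l.
Qed.

(** A color that occurs only at [w] in the whole graph serves every neighbor of [w]. *)
Lemma unique_color_nbhd k (f : {ffun G -> 'I_k}) v w :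
  adj v w -> (forall u, f u = f w -> u = w) ->
  [exists c, #|[set u in nbhd v | f u == c]| == 1].
Proof.
move=> vw fw; apply/existsP; exists (f w); apply/cards1P; exists w.
apply/setP => u; rewrite !inE.
by apply/andP/eqP => [[_ /eqP/fw] | ->].
Qed.

Lemma pcf_colorable_pseudo_split : C != set0 -> pcf_colorable G (#|C| + 3).
Proof.
move=> /set0Pn[x0 x0C]; have [g [ginj gS gadj]] := psp_C5 hpart hS.
have gin i : g i \in S by rewrite -gS imset_f.
(* The value 2 occurs only at index 4, which is [ord_max]. *)
pose col (i : 'I_5) := nth 0 [:: 0; 1; 0; 1; 2] i.
have col_lt3 i : col i < 3 by case: i => [[|[|[|[|[|?]]]]] ?].
have col_proper i j : C5_adj i j -> col i != col j.
  by case: i j => [[|[|[|[|[|?]]]]] ?] [[|[|[|[|[|?]]]]] ?].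
have col_max i : col i = 2 -> i = ord_max.
  by case: i => [[|[|[|[|[|?]]]]] ?] //= _; apply: val_inj.
(* Outside [C], [pick] recovers the position on the cycle; it fails exactly on [I], where the
   default 0 gives the color [#|C|]. *)
pose h v := if v \in C then index v (enum C)
            else #|C| + (if [pick i | g i == v] is Some i then col i else 0).
have hC v : v \in C -> h v < #|C|.
  by move=> vC; rewrite /h vC cardE index_mem mem_enum.
have hNC v : v \notin C -> #|C| <= h v.
  by move=> /negbTE vC; rewrite /h vC leq_addr.
have hg i : h (g i) = #|C| + col i.
  rewrite /h (disjointFl (psp_disjCS hpart) (gin i)).
  case: pickP => [j /eqP/ginj-> // | /(_ i)]; by rewrite eqxx.
have hI v : v \in I -> h v = #|C|.
  move=> vI; rewrite /h (disjointFl (psp_disjCI hpart) vI).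
  case: pickP => [j /eqP gj | _]; last by rewrite addn0.
  by rewrite -gj (disjointFr (psp_disjSI hpart) (gin j)) in vI.
have part v : [\/ v \in C, exists i, v = g i | v \in I].
  have: v \in C :|: S :|: I by rewrite (psp_cover hpart) inE.
  rewrite !inE -orbA -gS => /or3P[vC|/imsetP[i _ vi]|vI].
  - exact: Or31.
  - by apply: Or32; exists i.
  - exact: Or33.
have h_lt v : h v < #|C| + 3.
  case: (part v) => [vC | [i ->] | vI].
  - exact: ltn_addr (hC v vC).
  - by rewrite hg ltn_add2l.
  - by rewrite hI // -addn1 leq_add2l.
(* Colors below [#|C|] occur only on [C], where [index] is injective. *)
have h_uniqC u w : w \in C -> h u = h w -> u = w.
  move=> wC huw; have uC : u \in C.
    by apply/negPn/negP => /hNC; rewrite huw leqNgt hC.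
  move: huw; rewrite /h uC wC => /(congr1 (nth x0 (enum C))).
  by rewrite !nth_index ?mem_enum.
have h_uniqS u : h u = h (g ord_max) -> u = g ord_max.
  rewrite hg; case: (part u) => [uC | [i ->] | uI] hu.
  - by have := hC u uC; rewrite hu ltnNge leq_addr.
  - by move: hu; rewrite hg => /addnI/col_max->.
  - by move: hu; rewrite hI // -[LHS]addn0 => /addnI.
pose f := [ffun v => Ordinal (h_lt v)].
have fE u v : (f u == f v) = (h u == h v) by rewrite !ffunE.
have fh u v : f u = f v -> h u = h v by move/eqP; rewrite fE => /eqP.
apply/existsP; exists f; apply/andP; split.
  apply/forallP => u; apply/forallP => v; apply/implyP => uv; rewrite fE.
  apply/negP => /eqP huv.
  (* An edge with an end in [I] has its other end in [C], so each edge either meets [C], where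
     colors are unique, or lies in [S], where [col] is proper. *)
  suff E : u = v by rewrite E adj_irrefl in uv.
  case: (part v) => [vC | [j vj] | vI]; first exact: h_uniqC.
    case: (part u) => [uC | [i ui] | uI]; first by symmetry; apply: h_uniqC.
      subst u v; rewrite gadj in uv; move: huv; rewrite !hg => /addnI/eqP.
      by rewrite (negbTE (col_proper _ _ uv)).
    by apply: h_uniqC => //; apply: independent_part_nbhd uI uv.
  rewrite adj_sym in uv; symmetry; apply: h_uniqC => //.
  exact: independent_part_nbhd vI uv.
apply/forallP => v; apply/implyP => /set0Pn[w]; rewrite inE => vw.
case: (part v) => [vC | [i vi] | vI].
- apply: unique_color_nbhd (psp_complete hpart vC (gin ord_max)) _.
  by move=> u /fh/h_uniqS.
(* Nonemptiness of [C] enters here: [x0] is a uniquely colored neighbor of each cycle vertex. *)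
- have vx0 : adj v x0 by rewrite adj_sym vi (psp_complete hpart).
  by apply: (unique_color_nbhd vx0) => u /fh/h_uniqC; apply.
- apply: (unique_color_nbhd vw) => u /fh/h_uniqC; apply.
  exact: independent_part_nbhd vI vw.
Qed.

End PseudoSplit.

Theorem theorem9 (G : sgraph) (C S I : {set G})
    (hconn : connected_graph G)
    (hpart : pseudo_split_partition C S I)
    (hC : C != set0) (hS : S != set0) :
  chi_pcf G = omega G + 1.
Proof.
(* After reassociation the target is [#|C| + (2 + 1)], which is [#|C| + 3] by computation, as in
   both bounds. *)
rewrite (omega_pseudo_split hpart hS) -addnA /chi_pcf.
case: ex_minnP => k /existsP[f /andP[fproper _]] kmin.
apply/eqP; rewrite eqn_leq (proper_coloring_lower_bound hpart hS fproper) andbT.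
exact: kmin (pcf_colorable_pseudo_split hpart hS hC).
Qed.
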